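(* Let $Q$ be an idempotent quasigroup (finite or infinite). Then $Q$ is a DTS quasigroup if and only if all $x,y\in Q$ satisfy both of the following conditions: (i) $x\cdot xy = y = yx\cdot x$ or $xy\cdot x = y = x\cdot yx$; and (ii) $xy\cdot x = y$ implies $xy\cdot y = x$.
   Context: Juxtaposition binds tighter than the dot: $x\cdot xy$ means $x(xy)$, $xy\cdot x$ means $(xy)x$, etc. A quasigroup is a set with a binary operation such that for all $a,b$ the equations $au=b$ and $va=b$ have unique solutions $u,v$; it is idempotent if $xx=x$ for all $x$. A directed triple $\langle x,y,z\rangle$ ($x,y,z$ pairwise distinct) stands for the set of arrows $\{(x,y),(y,z),(x,z)\}$. A directed triple system (DTS) on a set $X$ (finite or infinite) is a set $\mathcal D$ of directed triples of elements of $X$ such that each ordered pair $(a,b)$ with $a\neq b$ in $X$ is an arrow of exactly one triple of $\mathcal D$. It induces a binary operation on $X$: $xx=x$ for all $x\in X$, and $xy=z$, $yz=x$, $xz=y$ whenever $\langle x,y,z\rangle\in\mathcal D$. If $X$ with this operation is a quasigroup, then $\mathcal D$ is called a Latin directed triple system (LDTS), and a quasigroup obtained in this way from some LDTS is called a DTS quasigroup. *)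

(* Defs.v *)
From mathcomp Require Import all_boot classical_sets.

Set Implicit Arguments.
Unset Strict Implicit.
Unset Printing Implicit Defensive.

Local Open Scope classical_set_scope.

Definition quasigroup (X : Type) (op : X -> X -> X) : Prop :=
  (forall a b, exists! u, op a u = b) /\ (forall a b, exists! v, op v a = b).

(* The set of arrows denoted by <x, y, z>; pairwise distinctness of x, y, z is
   required separately. *)
Definition dtriple (X : Type) (x y z : X) : set (X * X) :=
  [set (x, y); (y, z); (x, z)].

Definition directed_triple (X : Type) (T : set (X * X)) : Prop :=
  exists x y z, [/\ x <> y, y <> z, x <> z & T = dtriple x y z].

Definition DTS (X : Type) (D : set (set (X * X))) : Prop :=
  (forall T, D T -> directed_triple T) /\
  (forall a b, a <> b -> exists! T, D T /\ T (a, b)).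

(* A DTS induces exactly one operation (up to pointwise equality). Distinctness
   of x, y, z need not be assumed: otherwise dtriple x y z contains a loop, so
   it is not a directed triple. *)
Definition induced_op (X : Type) (D : set (set (X * X))) (op : X -> X -> X) :
    Prop :=
  (forall x, op x x = x) /\
  (forall x y z, D (dtriple x y z) -> [/\ op x y = z, op y z = x & op x z = y]).

Definition LDTS (X : Type) (D : set (set (X * X))) : Prop :=
  DTS D /\ exists op, induced_op D op /\ quasigroup op.

Definition DTS_quasigroup (X : Type) (op : X -> X -> X) : Prop :=
  exists D, LDTS D /\ induced_op D op.

(* Main.v *)
(** For an arrow (a,b) of a DTS with product c, the triple carrying it is
    <a,b,c>, <c,a,b> or <a,c,b>, and each possibility yields some of the
    required identities; the remaining ones follow because two triples that
    share an arrow coincide. Conversely, given (i) and (ii), every arrow lies in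
    some triple <x,y,z> with xy = z, yz = x and xz = y, and two such triples can
    share an arrow only if {x,y,z} is a totally symmetric subquasigroup. For
    such a 3-set a middle point is chosen, and only the two triples with this
    middle are retained. *)
Require Import Defs.
From mathcomp Require Import all_boot boolp classical_sets.

Set Implicit Arguments.
Unset Strict Implicit.
Unset Printing Implicit Defensive.

Local Open Scope classical_set_scope.

(* Selecting singletons rather than points avoids a default element: T may be
   empty. *)
Lemma singleton_selector (T : Type) : exists mid : set T -> set T,
  forall S, S !=set0 -> exists2 m, S m & mid S = [set m].
Proof.
suff /boolp.choice[mid midP] : forall S : set T, exists M : set T,
    S !=set0 -> exists2 m, S m & M = [set m] by exists mid.
move=> S; have [[m Sm]|S0] := pselect (S !=set0).
  by exists [set m] => _; exists m.
by exists set0.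
Qed.

Lemma quasigroup_lcancel (X : Type) (op : X -> X -> X) :
  quasigroup op -> forall a, injective (op a).
Proof.
move=> [op_l _] a u v e; have [w [_ uw]] := op_l a (op a v).
by rewrite -(uw u e) (uw v).
Qed.

Lemma quasigroup_rcancel (X : Type) (op : X -> X -> X) :
  quasigroup op -> forall a u v, op u a = op v a -> u = v.
Proof.
move=> [_ op_r] a u v e; have [w [_ uw]] := op_r a (op v a).
by rewrite -(uw u e) (uw v).
Qed.

(** * Directed triples as sets of arrows *)

Section Triples.
Variable X : Type.
Implicit Types (x y z a b c : X) (op : X -> X -> X).

Lemma dtripleE x y z a b :
  dtriple x y z (a, b) <->
  [\/ a = x /\ b = y, a = y /\ b = z | a = x /\ b = z].
Proof.
split.
  by move=> [[[-> ->]|[-> ->]]|[-> ->]];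
    [constructor 1|constructor 2|constructor 3].
by move=> [[-> ->]|[-> ->]|[-> ->]]; [left; left|left; right|right].
Qed.

(** The arrows of [dtriple x y z] order the three points linearly, and this order tells which point
    is first, middle and last. *)
Lemma dtriple_inj x y z x' y' z' : x <> y -> y <> z -> x <> z ->
  dtriple x y z = dtriple x' y' z' -> [/\ x = x', y = y' & z = z'].
Proof.
move=> nxy nyz nxz E.
have: dtriple x' y' z' (x, y) by rewrite -E; apply/dtripleE; constructor 1.
have: dtriple x' y' z' (y, z) by rewrite -E; apply/dtripleE; constructor 2.
have: dtriple x' y' z' (x, z) by rewrite -E; apply/dtripleE; constructor 3.
move=> /dtripleE h1 /dtripleE h2 /dtripleE h3.
by case: h1 => -[? ?]; case: h2 => -[? ?]; case: h3 => -[? ?]; split;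
  congruence.
Qed.

(** * From a DTS to the identities *)

Section Forward.
Variables (D : set (set (X * X))) (op : X -> X -> X).
Hypotheses (DTS_D : DTS D) (op_D : induced_op D op).

Lemma DTS_neq x y z : D (dtriple x y z) -> [/\ x <> y, y <> z & x <> z].
Proof.
move=> /DTS_D.1[x' [y' [z' [nxy nyz nxz /esym/(dtriple_inj nxy nyz nxz)]]]].
by move=> [<- <- <-].
Qed.

Lemma DTS_shared_arrow x y z x' y' z' a b :
  D (dtriple x y z) -> D (dtriple x' y' z') ->
  dtriple x y z (a, b) -> dtriple x' y' z' (a, b) ->
  [/\ x = x', y = y' & z = z'].
Proof.
move=> DT DT' Tab T'ab; have [nxy nyz nxz] := DTS_neq DT.
have nab : a <> b by case/dtripleE: Tab => -[-> ->].
have [T [_ uT]] := DTS_D.2 a b nab.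
by apply: dtriple_inj => //; rewrite -(uT _ (conj DT Tab))
  (uT _ (conj DT' T'ab)).
Qed.

Lemma arrow_triple a b : a <> b ->
  [\/ D (dtriple a b (op a b)), D (dtriple (op a b) a b)
    | D (dtriple a (op a b) b)].
Proof.
move=> /(DTS_D.2 a b)[T [[DT Tab] _]].
have [x [y [z [_ _ _ E]]]] := DTS_D.1 T DT; subst T.
have [xy yz xz] := op_D.2 _ _ _ DT.
by case/dtripleE: Tab => -[-> ->]; rewrite ?xy ?yz ?xz;
  [constructor 1|constructor 2|constructor 3].
Qed.

(** This lemma and the next two exclude rearrangements of the same points that share an arrow;
    [DTS_quasigroup_identities] discards its impossible cases with them. *)
Lemma DTS_no_first_swap x y z : D (dtriple x y z) -> D (dtriple y x z) -> False.
Proof.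
move=> DT DT'; have [nxy _ _] := DTS_neq DT; apply: nxy.
have [] := @DTS_shared_arrow _ _ _ _ _ _ x z DT DT' => //; apply/dtripleE.
  by constructor 3.
by constructor 2.
Qed.

Lemma DTS_no_last_swap x y z : D (dtriple x y z) -> D (dtriple x z y) -> False.
Proof.
move=> DT DT'; have [_ nyz _] := DTS_neq DT; apply: nyz.
have [] := @DTS_shared_arrow _ _ _ _ _ _ x z DT DT' => //; apply/dtripleE.
  by constructor 3.
by constructor 1.
Qed.

Lemma DTS_no_rotation x y z : D (dtriple x y z) -> D (dtriple y z x) -> False.
Proof.
move=> DT DT'; have [nxy _ _] := DTS_neq DT; apply: nxy.
have [] := @DTS_shared_arrow _ _ _ _ _ _ y z DT DT' => //; apply/dtripleE.
  by constructor 2.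
by constructor 1.
Qed.

Lemma DTS_quasigroup_identities : quasigroup op -> forall x y,
  ((op x (op x y) = y /\ y = op (op y x) x) \/
   (op (op x y) x = y /\ y = op x (op y x))) /\
  (op (op x y) x = y -> op (op x y) y = x).
Proof.
move=> op_quasigroup x y.
have injl := quasigroup_lcancel op_quasigroup.
have injr := quasigroup_rcancel op_quasigroup.
have op_id := op_D.1.
have [<-|nxy] := pselect (x = y); first by rewrite !op_id; split; [left|].
have nyx : y <> x by move=> /esym.
split.
  (* The positions of (x,y) and (y,x) in their triples make nine cases. In five the product
     equations already contain an alternative of (i). In the other four, cancellation gives xy = yx,
     so both triples lie on the same points and share an arrow. *)
  case: (arrow_triple nxy) (arrow_triple nyx) => D1 [] D2;
    have [e1 e2 e3] := op_D.2 _ _ _ D1; have [e4 e5 e6] := op_D.2 _ _ _ D2.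
  - have e : op x y = op y x by apply: (injl x); rewrite e3 e5.
    by case: (@DTS_no_first_swap x y (op x y)); rewrite // [in X in D X]e.
  - by left.
  - by left.
  - by right.
  - have e : op x y = op y x by apply: (injr x); rewrite e1 e6.
    by case: (@DTS_no_last_swap (op x y) x y); rewrite // [in X in D X]e.
  - have e : op x y = op y x by apply: (injr x); rewrite e1 e5.
    by case: (@DTS_no_rotation y (op x y) x); rewrite // [in X in D X]e.
  - have e : op x y = op y x by apply: (injl x); rewrite e1 e5.
    by case: (@DTS_no_rotation y x (op x y)); rewrite // [in X in D X]e.
  - by left.
  - by left.
have [D1|D1|D1] := arrow_triple nxy; have [e1 e2 e3] := op_D.2 _ _ _ D1 => // e.
(* Only <x,y,z> with z = xy is left. As zx = y, the triple through (z,x) has third point y: two of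
   its forms are rotations of <x,y,z>, and the last, <z,y,x>, gives zy = x. *)
have [nxy' nyz nxz] := DTS_neq D1.
have /arrow_triple : op x y <> x by move=> /esym.
rewrite e => -[D2|D2|D2].
- by case: (DTS_no_rotation D2 D1).
- by case: (DTS_no_rotation D1 D2).
- by have [] := op_D.2 _ _ _ D2.
Qed.

End Forward.

(** The equations that <x,y,z> would impose on the induced operation, stated without a system. *)
Definition op_triple op x y z := [/\ op x y = z, op y z = x & op x z = y].

(** * From the identities to a DTS *)

Section Backward.
Variable op : X -> X -> X.
Hypothesis op_quasigroup : quasigroup op.
Hypothesis op_id : forall x, op x x = x.
Hypothesis op_i : forall x y,
  (op x (op x y) = y /\ y = op (op y x) x) \/
  (op (op x y) x = y /\ y = op x (op y x)).
Hypothesis op_ii : forall x y, op (op x y) x = y -> op (op x y) y = x.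

Let injl := quasigroup_lcancel op_quasigroup.
Let injr := quasigroup_rcancel op_quasigroup.

Lemma op_triple_neq x y z : x <> y -> op_triple op x y z ->
  [/\ x <> y, y <> z & x <> z].
Proof.
move=> nxy [e1 e2 e3]; split=> // e; apply: nxy.
  by apply: (@injr y); rewrite op_id e1.
by apply: (@injl x); rewrite op_id e1.
Qed.

(** The second alternative of (i) at (a,b), completed by (ii), puts the product first. Under the
    first alternative, (i) at (b,a) decides between the product in the middle and at the end. *)
Lemma op_triple_arrow a b :
  [\/ op_triple op a b (op a b), op_triple op (op a b) a b
    | op_triple op a (op a b) b].
Proof.
case: (op_i a b) => -[h1 h2]; last first.
  by constructor 2; split=> //; apply: op_ii.
case: (op_i b a) => -[h3 h4]; first by constructor 3; split.
by constructor 1; split.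
Qed.

(** Two opposite orders together prescribe all six products of distinct points, so the notion is
    invariant under permutations. *)
Definition total_symmetric a b c :=
  op_triple op a b c /\ op_triple op c b a.

Lemma total_symmetricCA a b c :
  total_symmetric a b c -> total_symmetric b a c.
Proof. by move=> [[? ? ?] [? ? ?]]. Qed.

Lemma total_symmetricAC a b c :
  total_symmetric a b c -> total_symmetric a c b.
Proof. by move=> [[? ? ?] [? ? ?]]. Qed.

(** This lemma and the next two treat the pairs of distinct positions that (a,b) can occupy. Either
    alternative of (i) equates a product involving [op b a] with a known one, and cancellation gives
    ba = c. *)
Lemma op_triple_last_swap a b c :
  op_triple op a b c -> op_triple op a c b -> total_symmetric a b c.
Proof.
move=> [ab bc ac] [_ cb _].
have ba : op b a = c.
  have [[h _]|[h _]] := op_i b a; last by apply: (@injr b); rewrite h cb.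
  by apply: (@injl b); rewrite h bc.
have ca : op c a = b.
  have [[h _]|[h _]] := op_i c a; last by apply: (@injr c); rewrite h bc.
  by apply: (@injl c); rewrite h cb.
by [].
Qed.

Lemma op_triple_rotation a b c :
  op_triple op a b c -> op_triple op c a b -> total_symmetric a b c.
Proof.
move=> [ab bc ac] [ca _ cb].
have ba : op b a = c.
  have [[h _]|[h _]] := op_i b a; last by apply: (@injr b); rewrite h cb.
  by apply: (@injl b); rewrite h bc.
by [].
Qed.

Lemma op_triple_first_swap a b c :
  op_triple op a c b -> op_triple op c a b -> total_symmetric a b c.
Proof.
move=> [ac cb ab] [ca _ _].
have ba : op b a = c.
  have [[_ h]|[_ h]] := op_i a b; first by apply: (@injr a); rewrite -h ca.
  by apply: (@injl a); rewrite -h ac.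
(* Since ab = ba = c, each alternative of (i) contains bc = a. *)
have bc : op b c = a.
  have [[h _]|[_ h]] := op_i b a; first by rewrite -[in op b c]ba.
  by rewrite -ab -h.
by [].
Qed.

(** [mid] depends only on the underlying set, so all orders of a totally symmetric set refer to one
    middle m. The two triples with middle m are opposite and split the six arrows. *)
Definition chosen_triple (mid : set X -> set X) x y z :=
  [/\ x <> y, op_triple op x y z
    & total_symmetric x y z -> mid [set x; y; z] y].

Lemma DTS_quasigroup_of_identities : DTS_quasigroup op.
Proof.
have [mid midP] := singleton_selector X.
pose D := [set T | exists x y z, chosen_triple mid x y z /\ T = dtriple x y z].
have chosen_neq x y z : chosen_triple mid x y z -> [/\ x <> y, y <> z & x <> z].
  by move=> [nxy t _]; apply: op_triple_neq.
have D_op : induced_op D op.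
  split=> // x y z [x' [y' [z' [ch /esym E]]]].
  have [n1 n2 n3] := chosen_neq _ _ _ ch.
  by have [<- <- <-] := dtriple_inj n1 n2 n3 E; case: ch.
(* As [mid] takes a singleton value there, chosen triples on one totally symmetric set have equal
   middles. *)
have clash x y z x' y' z' : chosen_triple mid x y z ->
    chosen_triple mid x' y' z' -> total_symmetric x y z ->
    total_symmetric x' y' z' -> [set x'; y'; z'] = [set x; y; z] -> y = y'.
  move=> [_ _ my] [_ _ my'] /my{}my /my'{}my' E; move: my'; rewrite E.
  have [|m _ Em] := midP [set x; y; z]; first by exists x; left; left.
  by move: my; rewrite Em => -> ->.
have setAC a b c : [set a; c; b] = [set a; b; c] by rewrite setUAC.
have setrot a b c : [set c; a; b] = [set a; b; c] by rewrite setUAC setUC setUA.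
have arrowP a b T : D T -> T (a, b) -> let c := op a b in
    [\/ chosen_triple mid a b c /\ T = dtriple a b c,
        chosen_triple mid c a b /\ T = dtriple c a b
      | chosen_triple mid a c b /\ T = dtriple a c b].
  move=> [x [y [z [ch ->]]]] /dtripleE E /=; have [_ [e1 e2 e3] _] := ch.
  case: E => -[-> ->]; rewrite ?e1 ?e2 ?e3.
  - by constructor 1.
  - by constructor 2.
  - by constructor 3.
have DTS_D : DTS D.
  split.
    move=> T [x [y [z [ch ->]]]]; exists x, y, z.
    by have [] := chosen_neq _ _ _ ch.
  move=> a b nab.
  pose c := op a b.
  have nac : a <> c.
    by move=> e; apply: nab; apply: (@injl a); rewrite op_id -/c -e.
  have nca : c <> a by move=> /esym.
  have ts_rot : total_symmetric a b c -> total_symmetric c a b.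
    by move=> /total_symmetricAC /total_symmetricCA.
  have [T [DT Tab]] : exists T, D T /\ T (a, b).
    (* In the totally symmetric case the selected middle dictates the position of (a,b); otherwise
       the condition on [mid] is vacuous and any position that satisfies the equations will do. *)
    have [ts|nts] := pselect (total_symmetric a b c).
      have [|m Sm E] := midP [set a; b; c]; first by exists a; left; left.
      have mid_m : mid [set a; b; c] m by rewrite E.
      case: Sm mid_m => [[->|->]|->] mid_m.
      - exists (dtriple c a b); split; last by apply/dtripleE; constructor 2.
        exists c, a, b; split=> //; split=> //; last by rewrite setrot.
        by case: ts => [[? ? ?] [? ? ?]].
      - exists (dtriple a b c); split; last by apply/dtripleE; constructor 1.
        by exists a, b, c; split=> //; split=> //; case: ts.
      - exists (dtriple a c b); split; last by apply/dtripleE; constructor 3.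
        exists a, c, b; split=> //; split=> //; last by rewrite setAC.
        by case: ts => [[? ? ?] [? ? ?]].
    case: (op_triple_arrow a b); rewrite -/c => t.
    - exists (dtriple a b c); split; last by apply/dtripleE; constructor 1.
      by exists a, b, c.
    - exists (dtriple c a b); split; last by apply/dtripleE; constructor 2.
      exists c, a, b; split=> //; split=> // ts; case: nts.
      by apply/total_symmetricAC/total_symmetricCA.
    - exists (dtriple a c b); split; last by apply/dtripleE; constructor 3.
      exists a, c, b; split=> //; split=> // ts; case: nts.
      exact: total_symmetricAC.
  exists T; split=> // T' [DT' T'ab].
  have nbc : b <> c.
    by move=> e; apply: nab; apply: (@injr b); rewrite op_id -/c -e.
  (* Two positions of (a,b) force total symmetry, and their triples have different middles, against
     [clash]. *)
  have first_swap : chosen_triple mid a c b -> chosen_triple mid c a b -> False.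
    move=> ch ch'; have [_ t _] := ch; have [_ t' _] := ch'.
    have ts := op_triple_first_swap t t'; apply: nac; apply/esym.
    apply: (clash _ _ _ _ _ _ ch ch' (total_symmetricAC ts) (ts_rot ts)).
    by rewrite setrot setAC.
  have last_swap : chosen_triple mid a b c -> chosen_triple mid a c b -> False.
    move=> ch ch'; have [_ t _] := ch; have [_ t' _] := ch'.
    have ts := op_triple_last_swap t t'; apply: nbc.
    exact: (clash _ _ _ _ _ _ ch ch' ts (total_symmetricAC ts)).
  have rotation : chosen_triple mid a b c -> chosen_triple mid c a b -> False.
    move=> ch ch'; have [_ t _] := ch; have [_ t' _] := ch'.
    have ts := op_triple_rotation t t'; apply: nab; apply/esym.
    exact: (clash _ _ _ _ _ _ ch ch' ts (ts_rot ts)).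
  case: (arrowP a b T DT Tab) (arrowP a b T' DT' T'ab) =>
    -[ch ->] [] [ch' ->] //.
  - by case: (rotation ch ch').
  - by case: (last_swap ch ch').
  - by case: (rotation ch' ch).
  - by case: (first_swap ch' ch).
  - by case: (last_swap ch' ch).
  - by case: (first_swap ch ch').
by exists D; split=> //; split=> //; exists op.
Qed.

End Backward.
End Triples.

Theorem theorem1p6 (Q : Type) (op : Q -> Q -> Q)
    (op_quasigroup : quasigroup op) (op_idempotent : forall x, op x x = x) :
  DTS_quasigroup op <->
  forall x y : Q,
    ((op x (op x y) = y /\ y = op (op y x) x) \/
     (op (op x y) x = y /\ y = op x (op y x))) /\
    (op (op x y) x = y -> op (op x y) y = x).
Proof.
split=> [[D [[DTS_D _] op_D]]|ids].
  exact: DTS_quasigroup_identities DTS_D op_D op_quasigroup.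
by apply: DTS_quasigroup_of_identities => // x y; have [] := ids x y.
Qed.
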